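(* Let $f:[0,1]\to\mathbb{R}$ be a $C^2$ function such that $f'(0)\ge0$, $\inf f''>0$, $f'''$ exists and is bounded on $(0,1)$, and $f'f'''-(f'')^2\le0$ on $(0,1)$. There is a constant $C$ depending only on $f$ such that for all $M\in4\mathbb{N}$ sufficiently large depending on $f$, all $a_0\in[1,2]$ and $\delta_0\in(0,2-a_0]$, the set $F_M$ defined below satisfies $|F_M|\le C\delta_0M^{-2}$.
   Context: Fix $a_0\in[1,2]$, $\delta_0\in(0,2-a_0]$, $M\in4\mathbb{N}$, $m=M/2$, $a_n:=a_0+n\delta_02^{-M}$ for $n=0,\dots,2^M-1$, and $x_j:=2j/M$. Let $T_n:=\{(x,af(x)):x\in[0,1],\ a\in[a_n,a_n+\delta_02^{-M}]\}$. For $j\in\{1,\dots,m-1\}$ and each $n$ of the form $n=2^jk+2^{j-1}$ ($k=0,\dots,2^{M-j}-1$), let $(u_n^{(j)},v_n^{(j)})$ be the solution (with $x_j-u_n^{(j)}\in[0,1]$; it exists and is unique for $M$ large) of $$a_nf(x_j-u)+v=a_{n-2^{j-1}}f(x_j),\qquad a_nf'(x_j-u)=a_{n-2^{j-1}}f'(x_j).$$ For $n=\sum_{i=1}^M\varepsilon_i(n)2^{i-1}$ (binary expansion, $\varepsilon_i(n)\in\{0,1\}$) let $\lfloor n\rfloor_i:=n-(n\bmod2^{i-1})$, and set $u_n:=\sum_{i=1}^{m-1}\varepsilon_i(n)u^{(i)}_{\lfloor n\rfloor_i}$, $v_n:=\sum_{i=1}^{m-1}\varepsilon_i(n)v^{(i)}_{\lfloor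 n\rfloor_i}$ (the total translation of $T_n$ in the cut-and-slide construction, where at step $j$ the union of the already-grouped pieces with bottom curve $a_nf$ is translated so that this bottom curve becomes tangent at $x_j$ to the bottom curve $a_{n-2^{j-1}}f$). Define $$F_M:=\Big(\bigcup_{n=0}^{2^M-1}\big(T_n+(u_n,v_n)\big)\Big)\cap\Big(\Big[\tfrac{4\log_2M}{M},1\Big]\times\mathbb{R}\Big).$$ $|\cdot|$ denotes two-dimensional Lebesgue measure. *)

(* Defs.v *)
From HB Require Import structures.
From mathcomp Require Import all_boot all_order all_algebra.
From mathcomp Require Import all_classical all_reals all_analysis.
Set Implicit Arguments. Unset Strict Implicit. Unset Printing Implicit Defensive.
Import Order.TTheory GRing.Theory Num.Theory.
Import numFieldNormedType.Exports.
Local Open Scope classical_set_scope.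
Local Open Scope ring_scope.

(* [g'] is the derivative of [g] on the closed interval [0,1]
   (one-sided derivative at the endpoints 0 and 1). *)
Definition deriv_on01 (R : realType) (g g' : R -> R) : Prop :=
  forall x : R, x \in `[0, 1] ->
    (fun h : R => h^-1 * (g (x + h) - g x))
      @ (within (fun h : R => h != 0 /\ x + h \in `[0, 1]) (nbhs (0 : R)))
      --> g' x.

Definition good_f (R : realType) (f f1 f2 : R -> R) : Prop :=
  deriv_on01 f f1 /\ deriv_on01 f1 f2 /\
      {within `[0, 1], continuous f2} /\
      0 <= f1 0 /\
      (exists c : R, 0 < c /\ forall x, x \in `[0, 1] -> c <= f2 x) /\
      (forall x, x \in `]0, 1[ -> derivable f2 x 1) /\
      (exists B : R, forall x, x \in `]0, 1[ -> `|derive1 f2 x| <= B) /\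
    (forall x, x \in `]0, 1[ -> f1 x * derive1 f2 x - f2 x ^+ 2 <= 0).

Section Construction.
Variables (R : realType) (f f1 : R -> R) (a0 d0 : R) (M : nat).

Definition a_ (n : nat) : R := a0 + n%:R * d0 / 2 ^+ M.
Definition x_ (j : nat) : R := (2 * j)%:R / M%:R.
(* u_n^{(j)}: the solution u (with x_j - u in [0,1]) of
   a_n f'(x_j - u) = a_{n - 2^{j-1}} f'(x_j)  (unique when it exists since f' is
   strictly increasing on [0,1]) *)
Definition u_ (j n : nat) : R :=
  xget 0 [set u : R | x_ j - u \in `[0, 1] /\
                      a_ n * f1 (x_ j - u) = a_ (n - 2 ^ j.-1) * f1 (x_ j)].
Definition v_ (j n : nat) : R :=
  a_ (n - 2 ^ j.-1) * f (x_ j) - a_ n * f (x_ j - u_ j n).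
(* binary digit eps_i(n), i >= 1 *)
Definition eps_ (i n : nat) : nat := odd (n %/ 2 ^ i.-1).
Definition flr_ (n i : nat) : nat := n - n %% 2 ^ i.-1.
Definition U_ (n : nat) : R := \sum_(1 <= i < M./2) (eps_ i n)%:R * u_ i (flr_ n i).
Definition V_ (n : nat) : R := \sum_(1 <= i < M./2) (eps_ i n)%:R * v_ i (flr_ n i).
Definition T_ (n : nat) : set (R * R) :=
  [set p | exists x a : R, x \in `[0, 1] /\ a \in `[a_ n, a_ n + d0 / 2 ^+ M] /\
                           p = (x, a * f x)].
Definition Ttr_ (n : nat) : set (R * R) :=
  [set p | exists q, T_ n q /\ p = (q.1 + U_ n, q.2 + V_ n)].
Definition F_M : set (R * R) :=
  (\bigcup_(n in [set k : nat | (k < 2 ^ M)%N]) Ttr_ n) `&`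
  [set p | 4 * (ln (M%:R) / ln 2) / M%:R <= p.1 <= 1].
End Construction.

(* Main.v *)
Require Import Defs.
From HB Require Import structures.
From mathcomp Require Import all_boot all_order all_algebra.
From mathcomp Require Import all_classical all_reals all_analysis.
From mathcomp Require Import ring lra zify.
Import Order.TTheory GRing.Theory Num.Theory.
Import numFieldNormedType.Exports.
Local Open Scope classical_set_scope.
Local Open Scope ring_scope.

(** Set [eta = d0 / 2 ^+ M]. At step [i] two curves whose parameters differ by
    [2 ^ (i - 1) * eta] are made tangent at [x_i]; since the horizontal slide is
    also [O(2 ^ i * eta)] and [f''] is Lipschitz, their vertical distance at [x]
    is [O(2 ^ i * eta * (x - x_i) ^ 2)]. All later slides together move points
    horizontally by less than [1 / M]. Hence, for [x] between [x_j] and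
    [x_(j+1)], the [2 ^ j] pieces with the same digits above the [j]-th meet the
    vertical line through [x] within a single interval of length
    [O(eta * sum_(i <= j) 2 ^ i * ((j - i + 1) / M) ^ 2 + eta)
     = O(2 ^ j * eta / M ^ 2 + eta)].
    There are [2 ^ (M - j)] such groups, so the vertical section has measure
    [O(d0 / M ^ 2 + d0 / 2 ^ j)], and [x >= 4 log2 M / M] is exactly what makes
    [2 ^ j] at least [M ^ 2 / 2]. *)

(** * Derivatives on a closed segment, one-sided at its endpoints *)

Section DerivativeOnSegment.
Context {R : realType}.
Implicit Types (g dg : R -> R) (a b x y : R).

(** First-order expansion relative to the segment: this form passes directly to subsegments and to
    shifted arguments. *)
Definition has_deriv_on a b g dg : Prop :=
  forall x, a <= x <= b -> forall e, 0 < e ->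
  exists2 d, 0 < d & forall y, a <= y <= b -> `|y - x| < d ->
    `|g y - g x - dg x * (y - x)| <= e * `|y - x|.

Lemma deriv_on01_has_deriv_on g dg : deriv_on01 g dg -> has_deriv_on 0 1 g dg.
Proof.
move=> gP x x01 e e0.
have := gP x; rewrite in_itv /= => /(_ x01) /cvgrPdist_le /(_ e e0).
move=> [/= d d0 H]; exists d => // y y01 yxd.
have [->|yx] := eqVneq y x; first by rewrite !subrr mulr0 subr0 normr0 mulr0.
have yx0 : y - x != 0 by rewrite subr_eq0.
have := H (y - x); rewrite /= sub0r normrN => /(_ yxd).
have -> : x + (y - x) = y by ring.
rewrite in_itv /= => /(_ (conj yx0 y01)).
have -> : g y - g x - dg x * (y - x) =
          - ((dg x - (y - x)^-1 * (g y - g x)) * (y - x)) by field.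
by rewrite normrN normrM => h; rewrite ler_wpM2r.
Qed.

Lemma has_deriv_on_sub {a b} a' b' {g dg} : a <= a' -> b' <= b ->
  has_deriv_on a b g dg -> has_deriv_on a' b' g dg.
Proof.
move=> aa bb gP x /andP[ax xb] e e0.
have [|d d0 H] := gP x _ e e0; first by apply/andP; split; lra.
by exists d => // y /andP[ay yb]; apply: H; apply/andP; split; lra.
Qed.

Lemma has_deriv_on_continuous {a b g dg} :
  has_deriv_on a b g dg -> {within `[a, b], continuous g}.
Proof.
move=> gP; apply/subspace_continuousP => x /=; rewrite in_itv /= => xab.
apply/cvgrPdist_le => e e0.
have [d d0 H] := gP x xab 1 ltr01.
pose k := 1 + `|dg x|.
have k0 : 0 < k by rewrite /k; have := normr_ge0 (dg x); lra.
have dk : 0 < Num.min d (e / k) by rewrite lt_min d0 divr_gt0.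
exists (Num.min d (e / k)) => //= y; rewrite /= distrC lt_min => /andP[yd].
rewrite ltr_pdivlMr // => yk; rewrite in_itv /= => yab.
have {H} := H y yab yd; rewrite mul1r => H.
have -> : g x - g y = - ((g y - g x - dg x * (y - x)) + dg x * (y - x)).
  by ring.
rewrite normrN (le_trans (ler_normD _ _)) // normrM.
move: yk; rewrite /k; lra.
Qed.

Lemma has_deriv_on_is_derive {a b g dg} x :
  has_deriv_on a b g dg -> a < x < b -> is_derive x 1 g (dg x).
Proof.
move=> gP /andP[ax xb].
suff H : h^-1 *: ((g \o shift x) (h *: 1) - g x) @[h --> 0^'] --> dg x.
  by apply: DeriveDef; [apply/cvg_ex; exists (dg x)|exact: cvg_lim].
apply/cvgrPdist_le => e e0.
have xab : a <= x <= b by rewrite !ltW.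
have [d d0 H] := gP x xab e e0.
(* This radius keeps [h + x] inside the segment, so the relative derivative becomes an ordinary
   two-sided one. *)
pose r := Num.min d (Num.min (x - a) (b - x)).
have r0 : 0 < r by rewrite !lt_min d0 !subr_gt0 ax xb.
exists r => //= h; rewrite /= sub0r normrN !lt_min => /and3P[hd ha hb] h0.
have := H (h + x); rewrite addrK.
have hh := ler_norm h; have := ler_norm (- h); rewrite normrN => hh'.
have -> : a <= h + x <= b by apply/andP; split; lra.
move=> /(_ isT hd); rewrite /= [h *: 1]mulr1.
have -> : dg x - h^-1 *: (g (h + x) - g x) =
   - (h^-1 * (g (h + x) - g x - dg x * h)).
  by rewrite /GRing.scale /=; field.
by rewrite normrN normrM normfV ler_pdivrMl ?normr_gt0 // [_ * e]mulrC.
Qed.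

Lemma has_deriv_on_MVT {a b g dg} : a <= b -> has_deriv_on a b g dg ->
  exists2 c, a <= c <= b & g b - g a = dg c * (b - a).
Proof.
move=> ab gP.
have gD x : x \in `]a, b[ -> is_derive x 1 g (dg x).
  by rewrite in_itv /=; exact: has_deriv_on_is_derive.
have [c cab gc] := MVT_segment ab gD (has_deriv_on_continuous gP).
by exists c => //; move: cab; rewrite in_itv.
Qed.

Lemma has_deriv_on_norm_le {a b g dg} K : has_deriv_on a b g dg ->
  (forall x, a <= x <= b -> `|dg x| <= K) ->
  forall x y, a <= x <= b -> a <= y <= b -> `|g y - g x| <= K * `|y - x|.
Proof.
move=> gP dgK; suff H x y : x <= y -> a <= x <= b -> a <= y <= b ->
    `|g y - g x| <= K * `|y - x|.
  move=> x y xab yab; have [xy|/ltW xy] := leP x y; first exact: H.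
  by rewrite distrC (distrC y); apply: H.
move=> xy /andP[ax xb] /andP[ay yb].
have [c /andP[xc cy] ->] := has_deriv_on_MVT xy (has_deriv_on_sub x y ax yb gP).
by rewrite normrM ler_wpM2r // dgK //; apply/andP; split; lra.
Qed.

(** Applied to [f] and [f1], this differentiates the gap between two curves, one slid right by [u];
    both are defined over [[u, 1]]. *)
Lemma has_deriv_on_shift_combination {g dg} u p q : has_deriv_on 0 1 g dg ->
  0 <= u -> has_deriv_on u 1 (fun t => p * g (t - u) - q * g t)
                             (fun t => p * dg (t - u) - q * dg t).
Proof.
move=> gP u0 x /andP[ux x1] e e0.
(* The summand 1 keeps [k] positive even when [p] and [q] both vanish. *)
pose k := `|p| + `|q| + 1.
have k0 : 0 < k by rewrite /k; have := normr_ge0 p; have := normr_ge0 q; lra.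
have ek : 0 < e / k by rewrite divr_gt0.
have [|d d0 H] := gP x _ _ ek; first by apply/andP; split; lra.
have [|d' d'0 H'] := gP (x - u) _ _ ek; first by apply/andP; split; lra.
exists (Num.min d d'); first by rewrite lt_min d0.
move=> y /andP[uy y1]; rewrite lt_min => /andP[yd yd'].
have {}H := H y; have {}H' := H' (y - u).
rewrite [y - u - (x - u)](_ : _ = y - x) in H'; last by ring.
have /H {}H : 0 <= y <= 1 by apply/andP; split; lra.
have /H' {}H' : 0 <= y - u <= 1 by apply/andP; split; lra.
have {}H := H yd; have {}H' := H' yd'.
set A := g (y - u) - g (x - u) - _ in H'; set B := g y - g x - _ in H.
have -> : p * g (y - u) - q * g y - (p * g (x - u) - q * g x) -
   (p * dg (x - u) - q * dg x) * (y - x) = p * A - q * B.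
  by rewrite /A /B; ring.
rewrite (le_trans (ler_normB _ _)) // !normrM.
apply: (@le_trans _ _ ((`|p| + `|q|) * (e / k * `|y - x|))).
  by rewrite mulrDl lerD // ler_wpM2l.
rewrite mulrA ler_wpM2r // mulrCA ler_piMr ?(ltW e0) //.
by rewrite ler_pdivrMr // mul1r /k; lra.
Qed.

End DerivativeOnSegment.

(** * Uniform bounds on the profile, and translates made tangent *)

Record profile_bounds {R : realType} (f f1 f2 : R -> R) (B c : R) : Prop := ProfileBounds {
  pb_deriv : has_deriv_on 0 1 f f1;
  pb_deriv2 : has_deriv_on 0 1 f1 f2;
  pb_slope0 : 0 <= f1 0;
  pb_c_gt0 : 0 < c;
  pb_bound : forall x, 0 <= x <= 1 -> `|f x| <= B;
  pb_bound1 : forall x, 0 <= x <= 1 -> `|f1 x| <= B;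
  pb_bound2 : forall x, 0 <= x <= 1 -> `|f2 x| <= B;
  pb_convex : forall x, 0 <= x <= 1 -> c <= f2 x;
  pb_lip2 : forall x y, 0 <= x <= 1 -> 0 <= y <= 1 ->
    `|f2 y - f2 x| <= B * `|y - x| }.
Arguments pb_deriv {R f f1 f2 B c}.
Arguments pb_deriv2 {R f f1 f2 B c}.
Arguments pb_slope0 {R f f1 f2 B c}.
Arguments pb_c_gt0 {R f f1 f2 B c}.
Arguments pb_bound {R f f1 f2 B c}.
Arguments pb_bound1 {R f f1 f2 B c}.
Arguments pb_bound2 {R f f1 f2 B c}.
Arguments pb_convex {R f f1 f2 B c}.
Arguments pb_lip2 {R f f1 f2 B c}.

Section TangentTranslates.
Context {R : realType}.
Implicit Types (f g : R -> R) (B c t u w x : R).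

(** The bound on the third derivative makes [f2] Lipschitz by the mean value theorem. Bounds then
    descend from [f2] to [f1] to [f], each controlled by its value at 0 plus a bound on its
    derivative. *)
Lemma good_f_profile_bounds {f f1 f2} : good_f f f1 f2 ->
  exists B c, profile_bounds f f1 f2 B c.
Proof.
move=> [/deriv_on01_has_deriv_on fd [/deriv_on01_has_deriv_on f1d]].
move=> [f2c [f10 [[c [c0 f2ge]] [f2d [[B3 f3B] _]]]]].
have lipw x y : x <= y -> 0 <= x -> y <= 1 ->
    `|f2 y - f2 x| <= B3 * `|y - x|.
  move=> xy x0 y1; have [->|xneqy] := eqVneq x y.
    by rewrite !subrr normr0 mulr0.
  have f2D t : t \in `]x, y[ -> is_derive t 1 f2 ('D_1 f2 t).
    rewrite in_itv /= => /andP[xt ty]; apply: derivableP.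
    by apply: f2d; rewrite in_itv /=; apply/andP; split; lra.
  have xyc : {within `[x, y], continuous f2}.
    apply: continuous_subspaceW f2c => t /=; rewrite !in_itv /=.
    by move=> /andP[xt ty]; apply/andP; split; lra.
  have xy' : x < y by rewrite lt_neqAle xneqy.
  have [t] := MVT xy' f2D xyc; rewrite in_itv /= => /andP[xt ty] ->.
  rewrite normrM ler_wpM2r // -derive1E; apply: f3B.
  by rewrite in_itv /=; apply/andP; split; lra.
have lip x y : 0 <= x <= 1 -> 0 <= y <= 1 -> `|f2 y - f2 x| <= B3 * `|y - x|.
  move=> /andP[x0 x1] /andP[y0 y1]; have [xy|/ltW xy] := leP x y.
    exact: lipw.
  by rewrite distrC (distrC y); apply: lipw.
have bnd g K : (forall x, 0 <= x <= 1 -> `|g x - g 0| <= K * `|x - 0|) ->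
    forall x, 0 <= x <= 1 -> `|g x| <= `|g 0| + `|K|.
  move=> H x x01; rewrite -[g x](subrK (g 0)).
  rewrite (le_trans (ler_normD _ _)) // addrC lerD2l (le_trans (H _ x01)) //.
  rewrite subr0; have /andP[x0 x1] := x01; rewrite (ger0_norm x0).
  rewrite (le_trans (ler_norm _)) // normrM (ger0_norm x0).
  by rewrite ler_piMr.
have z01 : 0 <= (0 : R) <= 1 by rewrite lexx ler01.
have b2 := bnd f2 _ (fun x => lip 0 x z01).
have b1 := bnd f1 _ (fun x => has_deriv_on_norm_le _ f1d b2 0 x z01).
have b0 := bnd f _ (fun x => has_deriv_on_norm_le _ fd b1 0 x z01).
set K2 := `|f2 0| + _ in b2 b1 b0.
set K1 := `|f1 0| + _ in b1 b0.
set K0 := `|f 0| + _ in b0.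
have n0 : 0 <= K0 by rewrite addr_ge0.
have n1 : 0 <= K1 by rewrite addr_ge0.
have n2 : 0 <= K2 by rewrite addr_ge0.
have n3 := normr_ge0 B3.
exists (K0 + K1 + K2 + `|B3|), c; split => //.
- by move=> x /b0 h; lra.
- by move=> x /b1 h; lra.
- by move=> x /b2 h; lra.
- move=> x y x01 y01; rewrite (le_trans (lip _ _ x01 y01)) // ler_wpM2r //.
  by have := ler_norm B3; lra.
Qed.

Section WithBounds.
Context {f f1 f2 : R -> R} {B c : R}.
Hypothesis pb : profile_bounds f f1 f2 B c.

Lemma pb_ge0 : 0 <= B.
Proof. by rewrite (le_trans _ (pb_bound pb 0 _)) // lexx ler01. Qed.

Lemma pb_slope_incr x y : 0 <= x -> x <= y -> y <= 1 ->
  c * (y - x) <= f1 y - f1 x.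
Proof.
move=> x0 xy y1.
have [t /andP[xt ty] ->] :=
  has_deriv_on_MVT xy (has_deriv_on_sub x y x0 y1 (pb_deriv2 pb)).
rewrite ler_wpM2r ?subr_ge0 // (pb_convex pb) //.
by apply/andP; split; lra.
Qed.

Lemma pb_slope_ge0 x : 0 <= x <= 1 -> 0 <= f1 x.
Proof.
move=> /andP[x0 x1]; have := pb_slope_incr 0 x (lexx _) x0 x1.
have := mulr_ge0 (ltW (pb_c_gt0 pb)) x0; have := pb_slope0 pb.
by rewrite subr0; lra.
Qed.

(** The gap D(t) = p f(t - u) - q f(t) has D'(x) = 0 by tangency. Its second derivative (p - q)
    f''(t - u) + q (f''(t - u) - f''(t)) is O(|p - q|), since [f2] is Lipschitz and u = O(|p - q|).
    Two mean value inequalities give the quadratic bound. *)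
Lemma tangent_translate_close p q u x w :
  0 <= u -> u <= x <= 1 -> u <= w <= 1 -> `|q| <= 2 ->
  u <= B / c * `|p - q| -> p * f1 (x - u) = q * f1 x ->
  `|(p * f (w - u) - q * f w) - (p * f (x - u) - q * f x)|
     <= (B + 2 * B * (B / c)) * `|p - q| * (w - x) ^+ 2.
Proof.
move=> u0 ux1 uw1 q2 uB tang.
set K := (B + _) * _.
have B0 := pb_ge0; have c0 := pb_c_gt0 pb; have pq0 := normr_ge0 (p - q).
have Bc0 : 0 <= B / c by rewrite divr_ge0 // ltW.
have sd t : u <= t <= 1 -> `|p * f2 (t - u) - q * f2 t| <= K.
  move=> /andP[ut t1].
  have -> : p * f2 (t - u) - q * f2 t =
            (p - q) * f2 (t - u) + q * (f2 (t - u) - f2 t) by ring.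
  have tu01 : 0 <= t - u <= 1 by apply/andP; split; lra.
  have t01 : 0 <= t <= 1 by apply/andP; split; lra.
  rewrite (le_trans (ler_normD _ _)) // !normrM.
  have b2 := pb_bound2 pb _ tu01.
  have := pb_lip2 pb _ _ t01 tu01.
  rewrite [t - u - t](_ : _ = - u); last by ring.
  rewrite normrN (ger0_norm u0) => lp.
  apply: (@le_trans _ _ (`|p - q| * B + 2 * (B * (B / c * `|p - q|)))).
    rewrite lerD ?ler_wpM2l // ler_pM // (le_trans lp) // ler_wpM2l //.
  by rewrite le_eqVlt /K; apply/orP; left; apply/eqP; ring.
have fd t : u <= t <= 1 -> `|p * f1 (t - u) - q * f1 t| <= K * `|t - x|.
  move=> tu; have := has_deriv_on_norm_le _
    (has_deriv_on_shift_combination u p q (pb_deriv2 pb) u0) sd x t ux1 tu.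
  by rewrite tang subrr subr0.
have K0 : 0 <= K.
  by rewrite mulr_ge0 // addr_ge0 // mulr_ge0 // mulr_ge0.
(* On the segment between [w] and [x] the first derivative of the gap is at most [K * |w - x|]. *)
pose l := Num.min w x; pose r := Num.max w x.
have [/andP[ux x1] /andP[uw w1]] := (ux1, uw1).
have ul : u <= l by rewrite le_min uw.
have r1 : r <= 1 by rewrite ge_max w1.
have lr : [/\ l <= w <= r & l <= x <= r].
  by rewrite /l /r !ge_min !le_max !lexx !orbT.
have fd' t : l <= t <= r -> `|p * f1 (t - u) - q * f1 t| <= K * `|w - x|.
  move=> /andP[lt tr]; apply: le_trans (fd t _) _.
    by apply/andP; split; lra.
  rewrite ler_wpM2l //; move: lt tr; rewrite /l /r.
  have [wx|xw] := leP w x => h1 h2.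
    by rewrite !ler0_norm; lra.
  by rewrite !ger0_norm; lra.
have [lwr lxr] := lr.
have := has_deriv_on_norm_le _ (has_deriv_on_sub l r ul r1
  (has_deriv_on_shift_combination u p q (pb_deriv pb) u0)) fd' x w lxr lwr.
by rewrite -mulrA -expr2 real_normK ?num_real.
Qed.

(** Intermediate values of [f1] on [[0, x]]. The target q/p f'(x) is at least f'(0) because (p - q)
    f'(x) <= B (p - q) <= c x <= f'(x) - f'(0) <= p (f'(x) - f'(0)). *)
Lemma tangent_translation_exists p q x : 1 <= q -> q <= p -> 0 <= x <= 1 ->
  B * (p - q) <= c * x ->
  exists u, 0 <= x - u <= 1 /\ p * f1 (x - u) = q * f1 x.
Proof.
move=> q1 qp x01 h; have [/andP[x0 x1]] := x01.
have p0 : 0 < p by lra.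
have s0 := pb_slope_ge0 x x01.
have sB := le_trans (ler_norm _) (pb_bound1 pb x x01).
have inc := pb_slope_incr 0 x (lexx _) x0 x1; rewrite subr0 in inc.
have [||y] := @IVT _ f1 0 x (q / p * f1 x) x0.
- apply: continuous_subspaceW (has_deriv_on_continuous (pb_deriv2 pb)) => t /=.
  by rewrite !in_itv /= => /andP[t0 tx]; apply/andP; split; lra.
- apply/andP; split.
    rewrite ge_min; apply/orP; left.
    rewrite mulrAC ler_pdivlMr //.
    have sl0 := pb_slope0 pb.
    have : (p - q) * f1 x <= (p - q) * B by rewrite ler_wpM2l // subr_ge0.
    have : 0 <= (p - 1) * (f1 x - f1 0 - c * x) by rewrite mulr_ge0; lra.
    have : 0 <= (p - 1) * (c * x).
      by rewrite mulr_ge0 ?mulr_ge0 ?(ltW (pb_c_gt0 pb)) //; lra.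
    by lra.
  rewrite le_max; apply/orP; right.
  by rewrite ler_piMl // ler_pdivrMr // mul1r.
rewrite in_itv /= => /andP[y0 yx] fy.
exists (x - y); rewrite subKr; split; first by apply/andP; split; lra.
by rewrite fy; field; lra.
Qed.

(** Tangency reads p (f'(x) - f'(x - u)) = (p - q) f'(x), which lies between 0 and (p - q) B; since
    f' grows at rate at least [c], this bounds [u] on both sides. *)
Lemma tangent_translation_bounds p q x u : 1 <= q -> q <= p -> 0 <= x <= 1 ->
  0 <= x - u <= 1 -> p * f1 (x - u) = q * f1 x ->
  0 <= u <= B / c * (p - q).
Proof.
move=> q1 qp x01 xu01 tang; have [/andP[x0 x1] /andP[y0 y1]] := (x01, xu01).
have s0 := pb_slope_ge0 x x01; have c0 := pb_c_gt0 pb.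
have sB := le_trans (ler_norm _) (pb_bound1 pb x x01).
have dec : p * (f1 x - f1 (x - u)) = (p - q) * f1 x.
  by rewrite mulrBr tang; ring.
have d0 : 0 <= f1 x - f1 (x - u).
  rewrite -(@pmulr_rge0 _ p); last by lra.
  by rewrite dec mulr_ge0 // subr_ge0.
have u0 : 0 <= u.
  rewrite leNgt; apply/negP => un.
  have := pb_slope_incr x (x - u) x0.
  rewrite [x <= x - u](_ : _ = true); last by lra.
  move=> /(_ isT y1).
  have : 0 < c * (x - u - x) by rewrite mulr_gt0 //; lra.
  by lra.
rewrite u0 /= mulrAC ler_pdivlMr //.
have := pb_slope_incr (x - u) x y0.
rewrite [x - u <= x](_ : _ = true); last by lra.
move=> /(_ isT x1).
have : (p - q) * f1 x <= (p - q) * B by rewrite ler_wpM2l // subr_ge0.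
have : 0 <= (p - 1) * (f1 x - f1 (x - u)) by rewrite mulr_ge0 //; lra.
rewrite -dec; lra.
Qed.

End WithBounds.
End TangentTranslates.

(** * Binary digits and truncation *)

Section DyadicDigits.
Local Open Scope nat_scope.
Implicit Types i j k n : nat.

Lemma flr_mul n i : flr_ n i = n %/ 2 ^ i.-1 * 2 ^ i.-1.
Proof. by rewrite /flr_ {1}(divn_eq n (2 ^ i.-1)) addnK. Qed.

Lemma flr_le n i : flr_ n i <= n.
Proof. exact: leq_subr. Qed.

(** Clearing the [j] lowest digits does not affect the higher ones, so all later slides agree within
    a group of pieces. *)
Lemma div_truncation i j n : j <= i -> n %/ 2 ^ j * 2 ^ j %/ 2 ^ i = n %/ 2 ^ i.
Proof.
by move=> ji; rewrite -(subnKC ji) expnD !divnMA mulnK // expn_gt0.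
Qed.

Lemma eps_truncation i j n : j < i -> eps_ i (n %/ 2 ^ j * 2 ^ j) = eps_ i n.
Proof. by case: i => // i ji; rewrite /eps_ div_truncation. Qed.

Lemma flr_truncation i j n : j < i -> flr_ (n %/ 2 ^ j * 2 ^ j) i = flr_ n i.
Proof. by case: i => // i ji; rewrite !flr_mul div_truncation. Qed.

Lemma flr_split n i : flr_ n i.+1 = flr_ n i.+2 + eps_ i.+1 n * 2 ^ i.
Proof.
rewrite !flr_mul /= /eps_ /= expnSr divnMA mulnA -mulnAC -mulnDl addnC.
by congr (_ * _); rewrite {1}(divn_eq (n %/ 2 ^ i) 2) modn2 addnC.
Qed.

(** Ensures that the natural-number subtraction of [2 ^ i] in the tangency equation is not
    truncated. *)
Lemma flr_ge n i : odd (n %/ 2 ^ i) -> 2 ^ i <= flr_ n i.+1.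
Proof.
by move=> h; rewrite flr_mul /= leq_pmull //; case: (n %/ 2 ^ i) h.
Qed.

Lemma sum_expn_half i m : \sum_(i.+1 <= k < m) 2 ^ k.-1 <= 2 ^ m.
Proof.
elim: m => [|m IH]; first by rewrite big_geq.
have [im|mi] := leqP i.+1 m; last by rewrite big_geq.
rewrite big_nat_recr //= expnS mul2n -addnn leq_add // leq_exp2l //.
exact: leq_pred.
Qed.

End DyadicDigits.

(** * Slid curves and how tightly the pieces of a group bunch together *)

Section SlidCurves.
Context {R : realType} {f f1 f2 : R -> R} {B c : R}.
Hypothesis pb : profile_bounds f f1 f2 B c.
Context (a0 d0 : R) (M m : nat).
Hypothesis a0_range : 1 <= a0 <= 2.
Hypothesis d0_range : 0 < d0 <= 2 - a0.
Hypothesis m_gt0 : (0 < m)%N.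
Hypothesis M_eq : M = m.*2.
Hypothesis M_large : B / c * M%:R <= 2 ^+ m.

Local Notation eta := (d0 / 2 ^+ M).
Local Notation a_ := (a_ a0 d0 M).
Local Notation x_ := (x_ R M).
Local Notation u_ := (u_ f1 a0 d0 M).
Local Notation v_ := (v_ f f1 a0 d0 M).
Local Notation K := (B + 2 * B * (B / c)).

Lemma M_gt0 : 0 < M%:R :> R.
Proof. by rewrite ltr0n M_eq double_gt0. Qed.

Lemma eta_gt0 : 0 < eta.
Proof. by case/andP: d0_range => d00 _; rewrite divr_gt0 ?exprn_gt0. Qed.

Lemma K_ge0 : 0 <= K.
Proof.
have B0 := pb_ge0 pb.
by rewrite addr_ge0 // !mulr_ge0 // invr_ge0 ltW // (pb_c_gt0 pb).
Qed.

Lemma a_range n : (n < 2 ^ M)%N -> 1 <= a_ n <= 2.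
Proof.
move=> nM; have [/andP[a1 a2] /andP[d00 d2]] := (a0_range, d0_range).
have e0 := eta_gt0.
have h : n%:R * eta <= d0.
  rewrite mulrA ler_pdivrMr ?exprn_gt0 // mulrC ler_wpM2l ?(ltW d00) //.
  by rewrite -natrX ler_nat ltnW.
have : 0 <= n%:R * eta by rewrite mulr_ge0 // ltW.
by rewrite /Defs.a_ -mulrA => h'; apply/andP; split; lra.
Qed.

Lemma a_diff n k : (k <= n)%N -> a_ n - a_ (n - k) = k%:R * eta.
Proof. by move=> kn; rewrite /Defs.a_ natrB //; ring. Qed.

Lemma x_range i : (i <= m)%N -> 0 <= x_ i <= 1.
Proof.
move=> im; rewrite /Defs.x_ divr_ge0 //= ler_pdivrMr ?M_gt0 // mul1r.
by rewrite ler_nat M_eq -muln2 mulnC leq_mul2r im orbT.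
Qed.

(** Since M = 2m, the left side equals d0 (B / c) / 2^m, with d0 <= 1. It dominates the sum of all
    slides. *)
Lemma slide_le : B / c * (2 ^+ m * eta) <= M%:R^-1.
Proof.
have [/andP[a1 a2] /andP[d00 d2]] := (a0_range, d0_range).
have p0 : 0 < 2 ^+ m :> R by rewrite exprn_gt0.
have -> : B / c * (2 ^+ m * eta) = d0 * (B / c / 2 ^+ m).
  rewrite M_eq -addnn exprD; field.
  by rewrite lt0r_neq0 //= lt0r_neq0 // (pb_c_gt0 pb).
have h : B / c / 2 ^+ m <= M%:R^-1.
  by rewrite ler_pdivrMr // [_^-1 * _]mulrC ler_pdivlMr ?M_gt0.
have Bc : 0 <= B / c / 2 ^+ m.
  by rewrite !divr_ge0 ?(pb_ge0 pb) ?(ltW (pb_c_gt0 pb)) ?(ltW p0).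
by apply: le_trans h; rewrite ler_piMl //; lra.
Qed.

Lemma u_spec i N : (i.+1 < m)%N -> (2 ^ i <= N < 2 ^ M)%N ->
  [/\ 0 <= x_ i.+1 - u_ i.+1 N <= 1,
      a_ N * f1 (x_ i.+1 - u_ i.+1 N) = a_ (N - 2 ^ i) * f1 (x_ i.+1) &
      0 <= u_ i.+1 N <= B / c * (2 ^+ i * eta)].
Proof.
move=> im /andP[iN NM]; have c0 := pb_c_gt0 pb; have e0 := eta_gt0.
have x01 := x_range i.+1 (ltnW im).
have /andP[p1 _] := a_range _ NM.
have /andP[q1 _] := a_range _ (leq_ltn_trans (leq_subr (2 ^ i) N) NM).
have pq : a_ N - a_ (N - 2 ^ i) = 2 ^+ i * eta by rewrite a_diff // natrX.
have qp : a_ (N - 2 ^ i) <= a_ N.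
  by rewrite -subr_ge0 pq mulr_ge0 ?exprn_ge0 // ltW.
(* The slide bound is at most [1 / M], while the tangency abscissa is at least [2 / M]: there is
   room to the left of it. *)
have small : B * (a_ N - a_ (N - 2 ^ i)) <= c * x_ i.+1.
  rewrite pq -ler_pdivrMl // (mulrA c^-1) [c^-1 * B]mulrC.
  apply: le_trans (_ : M%:R^-1 <= _).
    apply: le_trans slide_le; rewrite ler_wpM2l //.
      by rewrite divr_ge0 ?(pb_ge0 pb) ?ltW.
    rewrite ler_wpM2r ?(ltW e0) // ler_weXn2l ?ler1n //.
    by apply: ltnW; apply: ltnW.
  rewrite /Defs.x_ -{1}[M%:R^-1]mul1r ler_wpM2r ?invr_ge0 ?(ltW M_gt0) //.
  by rewrite ler1n.
have [u0 [xu tang]] := tangent_translation_exists pb _ _ _ q1 qp x01 small.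
(* A solution exists, so [xget] returns a solution and not merely its default 0. *)
have [] : [set u : R | x_ i.+1 - u \in `[0, 1] /\
     a_ N * f1 (x_ i.+1 - u) = a_ (N - 2 ^ i) * f1 (x_ i.+1)] (u_ i.+1 N).
  by apply: (@xgetI _ 0 _ u0); rewrite /= in_itv.
rewrite in_itv /= => {}xu {}tang; split => //.
rewrite -pq.
exact: (tangent_translation_bounds pb _ _ _ _ q1 qp x01 xu tang).
Qed.

(** At [i = 0] this is the full translation [U_]; in general it involves only the digits above the
    [i]-th. *)
Definition U_from i n : R :=
  \sum_(i.+1 <= k < M./2) (eps_ k n)%:R * u_ k (flr_ n k).
Definition V_from i n : R :=
  \sum_(i.+1 <= k < M./2) (eps_ k n)%:R * v_ k (flr_ n k).

(* The lower boundary curve [a_N f], [N] being [n] with its [i] lowest binary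
   digits cleared, after the slides performed at the steps [k > i]. It is
   shared by all [n] with the same higher digits. *)
Definition slid_curve n i x : R :=
  a_ (flr_ n i.+1) * f (x - U_from i n) + V_from i n.

Lemma half_M : M./2 = m.
Proof. by rewrite M_eq doubleK. Qed.

Lemma slide_term_bounds n k : (n < 2 ^ M)%N -> (k.+1 < m)%N ->
  0 <= (eps_ k.+1 n)%:R * u_ k.+1 (flr_ n k.+1) <= B / c * (2 ^+ k * eta).
Proof.
move=> nM km; have [h|h] := boolP (odd (n %/ 2 ^ k)).
  have [|_ _] := u_spec k (flr_ n k.+1) km.
    by rewrite flr_ge //= (leq_ltn_trans (flr_le _ _)).
  by rewrite /eps_ /= h mul1r.
rewrite /eps_ /= (negbTE h) mul0r lexx /= !mulr_ge0 ?invr_ge0 ?exprn_ge0 //.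
- exact: pb_ge0 pb.
- exact: ltW (pb_c_gt0 pb).
- by case/andP: d0_range => /ltW.
Qed.

(** The slides are nonnegative and dominated by a geometric sum, which [slide_le] bounds. *)
Lemma U_from_bounds n i : (n < 2 ^ M)%N -> 0 <= U_from i n <= M%:R^-1.
Proof.
move=> nM; rewrite /U_from half_M; apply/andP; split.
  rewrite big_nat sumr_ge0 // => -[//|k] /andP[_ km].
  by case/andP: (slide_term_bounds _ _ nM km).
have Bc : 0 <= B / c by rewrite divr_ge0 ?(pb_ge0 pb) ?(ltW (pb_c_gt0 pb)).
apply: le_trans slide_le.
apply: (@le_trans _ _ (\sum_(i.+1 <= k < m) B / c * (2 ^+ k.-1 * eta))).
  rewrite big_nat [X in _ <= X]big_nat ler_sum // => -[//|k] /andP[_ km].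
  by case/andP: (slide_term_bounds _ _ nM km).
rewrite -mulr_sumr -mulr_suml ler_wpM2l // ler_wpM2r ?(ltW eta_gt0) //.
under eq_bigr do rewrite -natrX.
by rewrite -natr_sum -natrX ler_nat sum_expn_half.
Qed.

Lemma U_from_rec i n : (i.+1 < m)%N ->
  U_from i n = (eps_ i.+1 n)%:R * u_ i.+1 (flr_ n i.+1) + U_from i.+1 n.
Proof. by move=> im; rewrite /U_from half_M big_ltn. Qed.

Lemma V_from_rec i n : (i.+1 < m)%N ->
  V_from i n = (eps_ i.+1 n)%:R * v_ i.+1 (flr_ n i.+1) + V_from i.+1 n.
Proof. by move=> im; rewrite /V_from half_M big_ltn. Qed.

Lemma U_from_decr i n : (n < 2 ^ M)%N -> (i < m)%N -> U_from i n <= U_from 0 n.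
Proof.
move=> nM; elim: i => // i IH im; apply: le_trans (IH (ltnW im)).
rewrite (U_from_rec i) // lerDr.
by case/andP: (slide_term_bounds _ _ nM im).
Qed.

(** If digit [i + 1] is 0 the two curves coincide. Otherwise, after removing the later slides common
    to both, they are tangent at [x_ i.+1]. *)
Lemma slid_curve_step n i x : (n < 2 ^ M)%N -> (i.+1 < m)%N -> x <= 1 ->
  U_from 0 n <= x ->
  `|slid_curve n i x - slid_curve n i.+1 x| <=
    K * (2 ^+ i * eta) * (x - U_from i.+1 n - x_ i.+1) ^+ 2.
Proof.
move=> nM im x1 Ux; have e0 := eta_gt0.
have D0 : 0 <= 2 ^+ i * eta by rewrite mulr_ge0 ?exprn_ge0 ?ltW.
have K0 := K_ge0.
have Ui := U_from_rec i n im; have Vi := V_from_rec i n im.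
have /andP[Ui0 _] := U_from_bounds n i.+1 nM.
have Uix := le_trans (U_from_decr i n nM (ltnW im)) Ux.
rewrite /slid_curve Vi Ui (flr_split n i).
have [h|h] := boolP (odd (n %/ 2 ^ i)); last first.
  rewrite /eps_ /= (negbTE h) !mul0r !add0r addn0 subrr normr0.
  by rewrite mulr_ge0 ?sqr_ge0 // mulr_ge0.
have iN := flr_ge n i h.
have NM := leq_ltn_trans (flr_le n i.+1) nM.
have := u_spec i (flr_ n i.+1) im; rewrite iN NM => -[] // xu tang ub.
have /andP[u0 uB] := ub; have x01 := x_range i.+1 (ltnW im).
move: Ui; rewrite -(flr_split n i) /eps_ /= h !mul1r => Ui.
have flE : flr_ n i.+2 = (flr_ n i.+1 - 2 ^ i)%N.
  by rewrite (flr_split n i) /eps_ /= h mul1n addnK.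
rewrite flE; set N := flr_ n i.+1 in iN NM xu tang u0 uB Ui *.
set u := u_ i.+1 N in xu tang u0 uB Ui *.
set w := x - U_from i.+1 n.
have pq : a_ N - a_ (N - 2 ^ i) = 2 ^+ i * eta by rewrite a_diff // natrX.
have := @tangent_translate_close _ _ _ _ _ _ pb (a_ N) (a_ (N - 2 ^ i)) u
  (x_ i.+1) w u0.
rewrite pq (ger0_norm D0) => H.
(* The vertical shift [v_] is minus the gap at [x_ i.+1], so what remains is a difference of two
   values of the gap. *)
have -> : a_ N * f (x - (u + U_from i.+1 n)) + (v_ i.+1 N + V_from i.+1 n) -
    (a_ (N - 2 ^ i) * f w + V_from i.+1 n) =
    a_ N * f (w - u) - a_ (N - 2 ^ i) * f w -
    (a_ N * f (x_ i.+1 - u) - a_ (N - 2 ^ i) * f (x_ i.+1)).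
  rewrite /Defs.v_ -/u (_ : w - u = x - (u + U_from i.+1 n)); last first.
    by rewrite /w; ring.
  by rewrite /=; ring.
have /andP[? ?] := x01; have /andP[? ?] := xu.
apply: H => //; try by apply/andP; split; rewrite /w; lra.
have /andP[? ?] := a_range _ (leq_ltn_trans (leq_subr (2 ^ i) N) NM).
by rewrite ger0_norm //; lra.
Qed.

(* The weight [s ^+ 2 + 4 * s + 6] solves [2 p(s) = p(s + 1) + (s + 1) ^+ 2],
   so it absorbs the sum of [2 ^+ i * (j - i) ^+ 2]. *)
Lemma slid_curve_telescope n j t x : (n < 2 ^ M)%N -> (j < m)%N -> (t <= j)%N ->
  x_ j <= x -> x <= x_ j.+1 -> x <= 1 -> U_from 0 n <= x ->
  `|slid_curve n 0 x - slid_curve n t x| <=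
    4 * K * eta / M%:R ^+ 2 *
    (2 ^+ t * ((j - t)%:R ^+ 2 + 4 * (j - t)%:R + 6)).
Proof.
move=> nM jm + xj xj1 x1 Ux; have M0 := M_gt0; have e0 := eta_gt0.
have K0 := K_ge0.
have C0 : 0 <= 4 * K * eta / M%:R ^+ 2.
  by rewrite divr_ge0 ?exprn_ge0 ?(ltW M0) // mulr_ge0 ?(ltW e0) // mulr_ge0.
elim: t => [_|t IH tj].
  by rewrite subrr normr0 mulr_ge0 // mulr_ge0 // !addr_ge0 ?mulr_ge0 ?exprn_ge0.
have {}IH := IH (ltnW tj); have tm := leq_ltn_trans tj jm.
have step := slid_curve_step n t x nM tm x1 Ux.
rewrite (le_trans (ler_distD (slid_curve n t x) _ _)) //.
set s : R := (j - t.+1)%:R.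
have s0 : 0 <= s by [].
have jt : (j - t)%:R = s + 1 by rewrite /s natr1 -subSn // subSS.
rewrite jt in IH.
(* The upper bound on the distance comes from [x <= x_ j.+1]. On the other side the point can lie
   left of [x_ t.+1] only by the total slide, at most [1 / M]. *)
have sq : (x - U_from t.+1 n - x_ t.+1) ^+ 2 <= 4 / M%:R ^+ 2 * (s + 1) ^+ 2.
  have -> : 4 / M%:R ^+ 2 * (s + 1) ^+ 2 = (2 * (s + 1) / M%:R) ^+ 2.
    by field; rewrite lt0r_neq0.
  have /andP[U0 U1] := U_from_bounds n t.+1 nM.
  have jE : j%:R = s + t%:R + 1 :> R.
    by rewrite /s -addrA natr1 -natrD subnK.
  have i0 : 0 < M%:R^-1 :> R by rewrite invr_gt0.
  have l1 : x_ t.+1 <= x_ j.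
    by rewrite /Defs.x_ ler_wpM2r ?(ltW i0) // ler_nat leq_mul2l tj orbT.
  have l2 : x_ j.+1 - x_ t.+1 = 2 * (s + 1) / M%:R.
    by rewrite /Defs.x_ -mulrBl !natrM -!natr1 jE; congr (_ / _); ring.
  have l3 : M%:R^-1 <= 2 * (s + 1) / M%:R.
    by rewrite -{1}[M%:R^-1]mul1r ler_wpM2r ?(ltW i0) //; lra.
  rewrite -[X in X <= _]real_normK ?num_real // lerXn2r ?nnegrE //; first by lra.
  by rewrite ler_norml; apply/andP; split; lra.
have P0 : 0 <= K * (2 ^+ t * eta).
  by rewrite mulr_ge0 // mulr_ge0 ?exprn_ge0 // ltW.
have := le_trans step (ler_wpM2l P0 sq).
move: IH; set A := 4 * K * eta / _.
have -> : K * (2 ^+ t * eta) * (4 / M%:R ^+ 2 * (s + 1) ^+ 2) =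
  A * (2 ^+ t * (s + 1) ^+ 2) by rewrite /A; ring.
move=> h1 h2; apply: le_trans (lerD h1 h2) _.
by rewrite le_eqVlt [2 ^+ t.+1]exprS; apply/orP; left; apply/eqP; ring.
Qed.

(** Multiples of [2 ^ j] thus serve as representatives of the groups. *)
Lemma slid_curve_group n j x :
  slid_curve (n %/ 2 ^ j * 2 ^ j) j x = slid_curve n j x.
Proof.
rewrite /slid_curve flr_truncation //.
suff [-> ->] : U_from j (n %/ 2 ^ j * 2 ^ j) = U_from j n /\
               V_from j (n %/ 2 ^ j * 2 ^ j) = V_from j n by [].
split; apply: eq_big_nat => k /andP[jk _];
  by rewrite eps_truncation // flr_truncation.
Qed.

(** Within one piece the parameter varies by at most [eta], which costs [B * eta]; the telescoped
    slides give the rest. *)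
Lemma Ttr_group_close n j x y : (n < 2 ^ M)%N -> (j < m)%N ->
  x_ j <= x -> x <= x_ j.+1 -> x <= 1 -> Ttr_ f f1 a0 d0 M n (x, y) ->
  `|y - slid_curve (n %/ 2 ^ j * 2 ^ j) j x| <=
    24 * K * eta / M%:R ^+ 2 * 2 ^+ j + B * eta.
Proof.
move=> nM jm xj xj1 x1 [_ [[x' [a [x'01 [aE ->]]]] [/= xE yE]]].
move: x'01 aE; rewrite !in_itv /= => x'01 /andP[a1 a2].
have UE : U_from 0 n = U_ f1 a0 d0 M n by [].
have VE : V_from 0 n = V_ f f1 a0 d0 M n by [].
have /andP[x'0 _] := x'01.
have Ux : U_from 0 n <= x by rewrite xE UE lerDr.
have := slid_curve_telescope n j j x nM jm (leqnn _) xj xj1 x1 Ux.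
(* At [t = j] the weight is 6, whence the constant 24 = 4 * 6. *)
rewrite subnn expr0n /= mulr0 !add0r slid_curve_group => h.
rewrite (le_trans (ler_distD (slid_curve n 0 x) _ _)) // addrC lerD //.
  by rewrite (le_trans h) // le_eqVlt; apply/orP; left; apply/eqP; ring.
have -> : y - slid_curve n 0 x = (a - a_ n) * f x'.
  rewrite /slid_curve UE VE yE [flr_ n 1]flr_mul /= expn0 divn1 muln1.
  by rewrite xE addrK; ring.
rewrite normrM mulrC ler_pM //; first exact: pb_bound pb _ x'01.
by rewrite ger0_norm; lra.
Qed.

End SlidCurves.

(** * Bounding plane measure by vertical sections *)

Section Measure.
Context {R : realType}.
Local Notation mu := (@lebesgue_measure R).

(** The measure is the value of an outer measure, hence monotone on arbitrary sets. *)
Lemma lebesgue_measure_subset (A A' : set R) : A `<=` A' -> (mu A <= mu A')%E.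
Proof. by move=> AA'; exact: le_mu_ext. Qed.

Lemma lebesgue_measure_cover_balls (A : set R) (N : nat) (z : nat -> R)
    (rho : R) : 0 <= rho ->
  (forall y, A y -> exists2 k, (k < N)%N & `|y - z k| <= rho) ->
  (mu A <= (N%:R * (2 * rho))%:E)%E.
Proof.
move=> rho0 cov.
pose F k : set R := [set` `[z k - rho, z k + rho]].
have mF k : measurable (F k) by exact: measurable_itv.
have muF k : (mu (F k) <= (2 * rho)%:E)%E.
  rewrite lebesgue_measure_itv /=.
  case: ifPn => _; last by rewrite lee_fin mulr_ge0.
  by rewrite -EFinB lee_fin; lra.
have AF : A `<=` \big[setU/set0]_(k < N) F k.
  rewrite -bigcup_mkord => y /cov[k kN yk]; exists k => //=.
  by rewrite /F /= in_itv /= -ler_distl.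
apply: le_trans (lebesgue_measure_subset _ _ AF) _.
apply: le_trans (content_subadditive mu (fun k _ => mF k) _ (@subset_refl _ _)) _.
  by apply: bigsetU_measurable => k _; exact: mF.
rewrite (_ : (N%:R * (2 * rho))%:E = \sum_(k < N) (2 * rho)%:E); last first.
  by rewrite sumEFin sumr_const card_ord mulr_natl.
by apply: lee_sum => k _; exact: muF.
Qed.

(* [g] and [h] may be non-measurable: the integral of any nonnegative function
   is the supremum of the integrals of the simple functions below it. *)
Lemma integral_le (g h : R -> \bar R) : (forall x, 0 <= g x)%E ->
  (forall x, g x <= h x)%E -> (\int[mu]_x g x <= \int[mu]_x h x)%E.
Proof.
move=> g0 gh; have h0 x : (0 <= h x)%E := le_trans (g0 x) (gh x).
rewrite !ge0_integralTE //; apply: ereal_sup_le => _ [s sg <-].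
by exists s => // x; apply: le_trans (sg x) (gh x).
Qed.

(** The product measure unfolds to the integral of the section measures, which is compared with the
    function equal to [L] on [[0, 1]] and 0 elsewhere. *)
Lemma product_measure_le_sections (A : set (R * R)) (L : R) : 0 <= L ->
  (forall x y, A (x, y) -> 0 <= x <= 1) ->
  (forall x, 0 <= x <= 1 -> (mu (xsection A x) <= L%:E)%E) ->
  ((mu \x mu) A <= L%:E)%E.
Proof.
move=> L0 A01 AL.
pose D : set R := [set` `[0, 1]].
rewrite [leLHS](_ : _ = (\int[mu]_x (mu (xsection A x))%E)%E) //.
apply: (@le_trans _ _ (\int[mu]_x (cst L%:E \_ D) x)%E).
  apply: integral_le => x; first exact: measure_ge0.
  rewrite patchE; case: ifPn => [|xD].
    by rewrite inE /D /= in_itv /=; exact: AL.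
  rewrite (_ : xsection A x = set0) ?measure0 //.
  rewrite -subset0 => y /xsectionP /A01 x01; move/negP: xD; apply.
  by rewrite inE /D /= in_itv.
rewrite -integral_mkcond integral_cst /D /=; last exact: measurable_itv.
by rewrite lebesgue_measure_itv /= lte_fin ltr01 -EFinB subr0 mule1.
Qed.

End Measure.

(** * Choice of scale and conclusion *)

Lemma leq_sqr_expn2 m : (m * m <= 2 * 2 ^ m)%N.
Proof.
(* The induction uses (m + 1)^2 <= 2 m^2, valid from m = 3 on; smaller cases are computed. *)
have [|m3] := ltnP m 3; first by move: m => [|[|[|]]].
elim: m m3 => // m IH; rewrite leq_eqVlt => /orP[/eqP <- //|m3].
rewrite expnS; have := IH m3; move: (2 ^ m)%N => e; nia.
Qed.

(** Once m >= 4r, 2rm <= m^2 / 2 <= 2^m. With r = B / c this is the largeness condition on [M]. *)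
Lemma linear_le_exp2 {R : realType} (r : R) :
  exists m0, forall m, (m0 <= m)%N -> r * m.*2%:R <= 2 ^+ m.
Proof.
exists (Num.truncn (4 * r)).+1 => m m0m.
have r4 : 4 * r <= m%:R.
  by rewrite (le_trans (ltW (truncnS_gt _))) // ler_nat.
have := leq_sqr_expn2 m; rewrite -(ler_nat R) !natrM natrX => h.
have : 0 <= m%:R * (m%:R - 4 * r) by rewrite mulr_ge0 // subr_ge0.
by rewrite -muln2 natrM; lra.
Qed.

Lemma dyadic_scale {R : realType} (x : R) (m : nat) : (1 < m)%N ->
  4 * (ln m.*2%:R / ln 2) / m.*2%:R <= x -> x <= 1 ->
  exists2 j, (j < m)%N & [/\ x_ R m.*2 j <= x, x <= x_ R m.*2 j.+1 &
                             m.*2%:R ^+ 2 <= 2 * 2 ^+ j :> R].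
Proof.
move=> m1 xge x1; have m0 : 0 < m%:R :> R by rewrite ltr0n ltnW.
have M1 : 1 < m.*2%:R :> R by rewrite ltr1n -muln2; lia.
have M0 : 0 < m.*2%:R :> R by lra.
have l2 : 0 < ln 2 :> R by rewrite ln_gt0 // ltr1n.
have lM : 0 < ln m.*2%:R :> R by rewrite ln_gt0.
have x0 : 0 <= x by apply: le_trans xge; rewrite !mulr_ge0 ?invr_ge0 ?ltW.
have xE j : x_ R m.*2 j = j%:R / m%:R.
  by rewrite /x_ -muln2 !natrM; field; rewrite lt0r_neq0.
have [j jm [jx xj]] : exists2 j, (j < m)%N & j%:R <= x * m%:R /\
    x * m%:R <= j.+1%:R.
  have xm0 : 0 <= x * m%:R by rewrite mulr_ge0 // ltW.
  have /andP[t1 /ltW t2] := truncn_itv xm0.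
  have [tm|mt] := ltnP (Num.truncn (x * m%:R)) m.
    by exists (Num.truncn (x * m%:R)).
  (* Only [x = 1] arises here: its truncation is [m], so the last cell is taken. *)
  exists m.-1; first by rewrite ltn_predL ltnW.
  rewrite prednK; last exact: ltnW.
  split; last by rewrite ler_piMl // ltW.
  by rewrite (le_trans _ t1) // ler_nat (leq_trans (leq_pred _)).
exists j => //; rewrite !xE ler_pdivrMr // ler_pdivlMr //; split => //.
(* From [j + 1 >= x * m >= 2 log2 M] follows 2^(j + 1) >= M^2. *)
have l4 : ln m.*2%:R * 2 <= ln 2 * j.+1%:R :> R.
  rewrite -ler_pdivrMl //; apply: le_trans xj.
  move: xge; rewrite ler_pdivrMr // -muln2 natrM.
  by rewrite [_ / ln 2]mulrC; lra.
rewrite -exprS -ler_ln ?posrE ?exprn_gt0 // lnXn // lnXn //.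
by move: l4; rewrite !mulr_natr.
Qed.

(** The 2^(M - j) groups each fit in an interval of radius [rho]. As 2^M eta = d0, the total is 48 K
    d0 / M^2 + 2 B d0 / 2^j, and the choice of [j] bounds the last term by 4 B d0 / M^2. *)
Lemma section_measure_le {R : realType} {f f1 f2 : R -> R} {B c a0 d0 : R}
    (m j : nat) (x : R) :
  profile_bounds f f1 f2 B c -> 1 <= a0 <= 2 -> 0 < d0 <= 2 - a0 ->
  B / c * m.*2%:R <= 2 ^+ m -> (j < m)%N ->
  x_ R m.*2 j <= x -> x <= x_ R m.*2 j.+1 -> x <= 1 ->
  m.*2%:R ^+ 2 <= 2 * 2 ^+ j :> R ->
  (lebesgue_measure (xsection (F_M f f1 a0 d0 m.*2) x) <=
    ((48 * (B + 2 * B * (B / c)) + 4 * B) * d0 / m.*2%:R ^+ 2)%:E)%E.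
Proof.
move=> pb a0r d0r Ml jm xj xj1 x1 Mj.
have m0 : (0 < m)%N by apply: leq_ltn_trans jm.
set M := m.*2 in Ml xj xj1 Mj *.
have M0 : 0 < M%:R :> R by rewrite ltr0n double_gt0.
have jM : (j <= M)%N by rewrite (leq_trans (ltnW jm)) // /M -addnn leq_addr.
have B0 := pb_ge0 pb; have K0 := K_ge0 pb.
have /andP[d00 _] := d0r.
set K := B + _ in K0 *.
pose eta := d0 / 2 ^+ M.
have e0 : 0 < eta by rewrite divr_gt0 // exprn_gt0.
pose rho := 24 * K * eta / M%:R ^+ 2 * 2 ^+ j + B * eta.
have rho0 : 0 <= rho.
  rewrite addr_ge0 //; last by rewrite mulr_ge0 // ltW.
  by rewrite !mulr_ge0 ?invr_ge0 ?exprn_ge0 // ltW.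
pose z k := slid_curve (f := f) (f1 := f1) a0 d0 M (k * 2 ^ j)%N j x.
apply: le_trans (lebesgue_measure_cover_balls _ (2 ^ (M - j)) z rho rho0 _) _.
  move=> y /xsectionP [[n /= nM Tn] _].
  exists (n %/ 2 ^ j)%N; first by rewrite ltn_divLR ?expn_gt0 // -expnD subnK.
  exact: (Ttr_group_close pb a0 d0 M m a0r d0r m0 erefl Ml n j x y nM jm).
rewrite lee_fin natrX.
have p0 : 0 < 2 ^+ j :> R by rewrite exprn_gt0.
have -> : 2 ^+ (M - j) = 2 ^+ M / 2 ^+ j :> R.
  by rewrite -{2}(subnK jM) exprD mulfK // lt0r_neq0.
have -> : 2 ^+ M / 2 ^+ j * (2 * rho) =
    48 * K * d0 / M%:R ^+ 2 + 2 * B * d0 * (2 ^+ j)^-1.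
  by rewrite /rho /eta; field; rewrite !lt0r_neq0 // exprn_gt0.
have jinv : (2 ^+ j)^-1 <= 2 / M%:R ^+ 2 :> R.
  by rewrite ler_pdivlMr ?exprn_gt0 // mulrC ler_pdivrMr.
have : 2 * B * d0 * (2 ^+ j)^-1 <= 2 * B * d0 * (2 / M%:R ^+ 2).
  by rewrite ler_wpM2l // !mulr_ge0 // ltW.
by lra.
Qed.

Theorem theorem2p3 (R : realType) (f f1 f2 : R -> R) :
  good_f f f1 f2 ->
  exists C : R, exists M0 : nat, forall M : nat, (M0 <= M)%N -> (4 %| M)%N ->
    forall a0 d0 : R, 1 <= a0 <= 2 -> 0 < d0 <= 2 - a0 ->
      ((@lebesgue_measure R \x @lebesgue_measure R) (F_M f f1 a0 d0 M)
        <= (C * d0 / (M%:R ^+ 2))%:E)%E.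
Proof.
move=> /good_f_profile_bounds[B [c pb]].
have [m0 m0P] := linear_le_exp2 (B / c).
(* The threshold gives m >= m0 for small slides and m >= 2 for the choice of scale. *)
exists (48 * (B + 2 * B * (B / c)) + 4 * B), (maxn m0 2).*2 => M M0M M4 a0 d0.
move=> a0r d0r; have ME : M = M./2.*2.
  by rewrite even_halfK //; move/dvdnP: M4 => [k ->]; rewrite oddM andbF.
move: M0M; rewrite {1}ME leq_double geq_max => /andP[m0m m2].
rewrite ME; move: (M./2) m0m m2 => m m0m m2.
have M1 : 1 <= m.*2%:R :> R by rewrite ler1n double_gt0 ltnW.
have L0 : 0 <= (48 * (B + 2 * B * (B / c)) + 4 * B) * d0 / m.*2%:R ^+ 2.
  have /andP[/ltW d00 _] := d0r.
  rewrite !mulr_ge0 ?invr_ge0 ?exprn_ge0 // addr_ge0 ?mulr_ge0 ?(K_ge0 pb) //.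
  exact: pb_ge0 pb.
have F_range x y : F_M f f1 a0 d0 m.*2 (x, y) ->
    4 * (ln m.*2%:R / ln 2) / m.*2%:R <= x <= 1 by case.
apply: product_measure_le_sections => // [x y /F_range/andP[xge ->]|x x01].
  rewrite andbT; apply: le_trans xge.
  by rewrite !mulr_ge0 ?invr_ge0 ?ln_ge0 // ler1n.
(* A point in a nonempty section certifies that [x] lies in the range where a scale [j] exists. *)
have [->|/set0P[y /xsectionP /F_range/andP[xge x1]]] :=
    eqVneq (xsection (F_M f f1 a0 d0 m.*2) x) set0.
  by rewrite measure0.
have [j jm [xj xj1 Mj]] := dyadic_scale x m m2 xge x1.
exact: section_measure_le pb a0r d0r (m0P _ m0m) jm xj xj1 x1 Mj.
Qed.
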